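(* Let $A$ and $B$ be bounded subsets of $\mathbb{R}$ with $\lambda(B)\neq0$. Write $D_A=\mathrm{diam}(A)$, $D_B=\mathrm{diam}(B)$, and let $K$ be the positive integer and $\delta\in[0,1)$ the real number such that $$\frac{\lambda(A)}{\lambda(B)}=\frac{K(K-1)}{2}+K\delta .$$ Then either $\lambda(A+B)\ge\lambda(A)+D_B$ or $$\lambda(A+B)\ge\lambda(A)+(K+\delta)\lambda(B).$$ Furthermore, if $D_A>0$ and $D_A/D_B\le K$, then either $\lambda(A+B)\ge\lambda(A)+D_B$ or $$\lambda(A+B)\ge\frac{\lceil D_A/D_B\rceil+1}{\lceil D_A/D_B\rceil}\lambda(A)+\frac{\lceil D_A/D_B\rceil+1}{2}\lambda(B).$$
   Context: $\lambda$ denotes the inner Lebesgue measure on $\mathbb{R}$; for a bounded set $S\subset\mathbb{R}$, $\mathrm{diam}(S)=\sup(S)-\inf(S)$; $A+B=\{a+b:a\in A,b\in B\}$. *)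

(* Defs.v *)
From HB Require Import structures.
From mathcomp Require Import all_boot all_order all_algebra.
From mathcomp Require Import all_classical all_reals all_analysis.

Set Implicit Arguments.
Unset Strict Implicit.
Unset Printing Implicit Defensive.

Import Order.TTheory GRing.Theory Num.Theory.
Import numFieldNormedType.Exports.

Local Open Scope classical_set_scope.
Local Open Scope ring_scope.

Definition inner_lebesgue_measure (R : realType) (S : set R) : \bar R :=
  ereal_sup [set lebesgue_measure C | C in [set C : set R | compact C /\ C `<=` S]].

(* [fine] sends infinite values to 0; only meaningful when the inner measure
   of S is finite, in particular when S is bounded. *)
Definition inner_lambda (R : realType) (S : set R) : R :=
  fine (inner_lebesgue_measure S).

(* Only meaningful for S nonempty and bounded: otherwise [sup S] or [inf S] is
   a default value. *)
Definition diam (R : realType) (S : set R) : R := sup S - inf S.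

Definition sumset (R : realType) (A B : set R) : set R :=
  [set a + b | a in A & b in B].

(* Main.v *)
(* Ruzsa's argument, run in Z/p instead of a circle. Put D = diam B and split R
   into cells of length h = D / p with p a large prime, so that B becomes a set
   of integers in [0, p] containing both 0 and p. Let A_k be the set of residues
   mod p that have at least k representatives in the discretised A, and S_k the
   same for A + B. Since 0 and p are in B, S_{k+1} contains A_k; and S_k contains
   A_k + B mod p, so by Cauchy-Davenport |S_k| >= |A_k| + |B| - 2 unless it is
   everything. If S_1 is everything, then |A + B| >= p + |A|. Otherwise averaging
   the two lower bounds for S_k gives
     |A + B| >= (n + 1) / n |A| + (n + 1) / 2 (|B| - 2)
   where n is the largest number of elements of A in a residue class.
   Letting p tend to infinity yields the analogue for compact sets, and inner
   approximation the general case. As a function of n the bound decreases up to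
   n = K and is minimal there, and n <= ceil (diam A / diam B) up to shrinking A
   slightly. *)
Require Import Defs.
From HB Require Import structures.
From mathcomp Require Import all_boot all_order all_algebra.
From mathcomp Require Import zify ring lra.

Set Implicit Arguments.
Unset Strict Implicit.
Unset Printing Implicit Defensive.

Import Order.TTheory GRing.Theory Num.Theory.

Local Open Scope ring_scope.

(** * Sums of finite sets of integers *)

(** A nonzero [d] generates the additive group: every [x] is [a] plus a multiple of [d], with
    multiplier [(x - a) / d] read as a natural number. *)
Lemma Fp_closed_translate (p : nat) (A : {set 'F_p}) (d : 'F_p) :
  prime p -> A != set0 -> d != 0 -> (forall a, a \in A -> a + d \in A) ->
  A = [set: 'F_p].
Proof.
move=> pp /set0Pn[a aA] d0 Ad; apply/setP => x; rewrite inE.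
have Adn n : a + d *+ n \in A.
  by elim: n => [|n IHn]; rewrite ?mulr0n ?addr0 // mulrSr addrA Ad.
have -> : x = a + d *+ ((x - a) / d : 'F_p).
  by rewrite -mulr_natr natr_Zp mulrC divfK // addrC subrK.
exact: Adn.
Qed.

(** Dyson's transform: [A] and [B] give way to the union and the intersection of [A] with [B + e],
    which keeps the total size and sends the sumset into [S + e]. The shift [e] makes [B + e] meet
    [A] without lying inside it, so the second set is nonempty and smaller than [B]. *)
Theorem Cauchy_Davenport (p : nat) (A B : {set 'F_p}) :
  prime p -> A != set0 -> B != set0 ->
  (minn p (#|A| + #|B|).-1 <= #|[set (a + b)%R | a in A, b in B]|)%N.
Proof.
move=> pp; have [n] := ubnP #|B|; elim: n => // n IHn in A B * => leBn A0 B0.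
set S := [set _ | _ in _, _ in _].
have [b bB] := set0Pn _ B0.
have shiftS : (#|A| <= #|S|)%N.
  rewrite -(card_imset A (@addIr _ b)); apply/subset_leq_card/subsetP.
  by move=> _ /imsetP[a aA ->]; apply/imset2P; exists a b.
have [B1|] := leqP #|B| 1.
  by rewrite (leq_trans (geq_minr _ _)) //; lia.
move=> /card_gt1P[b1 [b2 [b1B b2B b12]]].
have [AT|AnT] := eqVneq A [set: 'F_p].
  move: shiftS; rewrite {1}AT cardsT card_Fp // => ?.
  by rewrite (leq_trans (geq_minl _ _)).
(* Otherwise A would be invariant under translation by b2 - b1. *)
have [e [e1 e2]] : exists e, [exists b in B, b + e \in A] /\
    [exists b in B, b + e \notin A].
  have [/existsP[a /andP[aA aN]]|noa] :=
      boolP [exists a, (a \in A) && (a + (b2 - b1) \notin A)].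
    exists (a - b1); split; apply/exists_inP.
      by exists b1; rewrite // addrC subrK.
    by exists b2; rewrite // addrCA.
  case/eqP: AnT; apply: (@Fp_closed_translate _ _ (b2 - b1)) => //.
    by rewrite subr_eq0 eq_sym.
  move=> a aA; apply: contraNT noa => aN; apply/existsP; exists a.
  by rewrite aA.
pose Be := [set b + e | b in B].
have BeE : #|Be| = #|B| by rewrite card_imset //; exact: addIr.
have mBe c : c \in B -> c + e \in Be by move=> cB; apply/imsetP; exists c.
have IBe : A :&: Be != set0.
  have /exists_inP[c cB ceA] := e1.
  by apply/set0Pn; exists (c + e); rewrite inE ceA mBe.
have UBe : A :|: Be != set0.
  by case/set0Pn: A0 => a aA; apply/set0Pn; exists a; rewrite inE aA.
have ltI : (#|A :&: Be| < #|B|)%N.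
  rewrite -BeE proper_card //; apply/properP; split; first exact: subsetIr.
  have /exists_inP[c cB ceA] := e2.
  by exists (c + e); rewrite ?mBe // inE negb_and ceA.
have := IHn (A :|: Be) (A :&: Be) (leq_trans ltI leBn) UBe IBe.
have := cardsUI A Be; rewrite BeE => ->.
move/leq_trans; apply.
rewrite -(card_imset S (@addIr _ e)); apply/subset_leq_card/subsetP.
move=> _ /imset2P[x y + /setIP[yA /imsetP[b' b'B yE]] ->].
case/setUP => [xA|/imsetP[b'' b''B xE]].
- apply/imsetP; exists (x + b'); last by rewrite yE addrA.
  by apply/imset2P; exists x b'.
- apply/imsetP; exists (y + b''); last by rewrite xE addrC addrA.
  by apply/imset2P; exists y b''.
Qed.

(** Double counting of the pairs [(k, x)] with [k < f x]. *)
Lemma sum_card_level (T : finType) (f : T -> nat) (m : nat) :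
  (\sum_(k < m) #|[set x | (k < f x)%N]| = \sum_x minn (f x) m)%N.
Proof.
under [LHS]eq_bigr do rewrite -sum1_card big_mkcond /=.
rewrite exchange_big /=; apply: eq_bigr => x _.
under eq_bigr do rewrite inE.
elim: m => [|m IHm]; first by rewrite big_ord0 minn0.
by rewrite big_ord_recr /= IHm; case: ifP; lia.
Qed.

(* Write n * s k as (n - k) * s k + k * s k: the first hypothesis applies to the
   former part, the second one to the latter. *)
Lemma interlaced_sum_le (n b : nat) (a s : nat -> nat) :
  (forall k, k < n -> a k + b <= s k)%N ->
  (forall k, k < n -> a k <= s k.+1)%N ->
  (2 * n.+1 * (\sum_(k < n) a k) + n * n.+1 * b <= 2 * n * (\sum_(k < n.+1) s k))%N.
Proof.
move=> hs hsS.
have -> : (2 * n * (\sum_(k < n.+1) s k) =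
   2 * (\sum_(k < n.+1) (n - k) * s k) + 2 * (\sum_(k < n.+1) k * s k))%N.
  rewrite -mulnDr -mulnA -big_split /= big_distrr /=; congr (_ * _)%N.
  by apply: eq_bigr => k _; rewrite -mulnDl subnK // -ltnS.
(* The weight [n - k] vanishes at [k = n] and the weight [k] at [k = 0], exactly where the
   respective hypothesis says nothing about [s k]. *)
have h1 : (\sum_(k < n) (n - k) * (a k + b) <= \sum_(k < n.+1) (n - k) * s k)%N.
  rewrite big_ord_recr /= subnn mul0n addn0; apply: leq_sum => k _.
  by rewrite leq_mul2l hs ?orbT.
have h2 : (\sum_(k < n) k.+1 * a k <= \sum_(k < n.+1) k * s k)%N.
  rewrite big_ord_recl /= mul0n add0n; apply: leq_sum => k _.
  by rewrite /bump /= add1n leq_mul2l hsS ?orbT.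
(* Each [a k] has total weight [(n - k) + (k + 1) = n + 1], and the weights of [b] add up to
   [n (n + 1) / 2]. *)
have h3 : (2 * (\sum_(k < n) (n - k) * (a k + b)) + 2 * (\sum_(k < n) k.+1 * a k)
   = 2 * n.+1 * (\sum_(k < n) a k) + n * n.+1 * b)%N.
  have -> : (n * n.+1 * b = 2 * (\sum_(k < n) (n - k) * b))%N.
    rewrite -big_distrl /= mulnA; congr (_ * _)%N.
    elim: (n) => [|j IHj]; first by rewrite big_ord0.
    rewrite big_ord_recl subn0 mulnDr; under eq_bigr do rewrite subSS.
    by rewrite -IHj; lia.
  rewrite -!mulnA -!mulnDr; congr (_ * _)%N.
  rewrite big_distrr /= -!big_split /=; apply: eq_bigr => k _.
  have := ltn_ord k; nia.
by rewrite -h3 leq_add // leq_mul2l.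
Qed.

(** * Integers grouped by residue class *)

Definition fibre (p : nat) (s : seq nat) (x : 'F_p) : seq nat :=
  [seq i <- s | i%:R == x].

Lemma sum_size_fibre (p : nat) (s : seq nat) :
  (\sum_(x : 'F_p) size (fibre s x) = size s)%N.
Proof.
under eq_bigr do rewrite size_filter -sum1_count.
under eq_bigr do rewrite big_mkcond /=.
rewrite exchange_big /= -sum1_size; apply: eq_bigr => i _.
by rewrite -big_mkcond /= (big_pred1 (i%:R : 'F_p)) // => x; rewrite /= eq_sym.
Qed.

(** An integer is determined by its residue and its quotient by [p], and the quotients are below
    [m]. *)
Lemma size_fibre_le (p m : nat) (s : seq nat) (x : 'F_p) : prime p ->
  uniq s -> (forall i, i \in s -> i < m * p)%N -> (size (fibre s x) <= m)%N.
Proof.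
move=> pp us sm; have p0 := prime_gt0 pp.
rewrite -[leqRHS](size_iota 0) -(size_map (fun i => i %/ p)%N).
apply: uniq_leq_size => [|_ /mapP[i + ->]]; last first.
  by rewrite mem_filter => /andP[_ /sm im]; rewrite mem_iota add0n ltn_divLR.
rewrite map_inj_in_uniq ?filter_uniq // => i j.
rewrite !mem_filter => /andP[/eqP ix _] /andP[/eqP jx _] ij.
have := congr1 val (etrans ix (esym jx)).
rewrite /= !val_Fp_nat // => e.
by rewrite (divn_eq i p) (divn_eq j p) ij e.
Qed.

Lemma mem_fibre (p : nat) (s : seq nat) (x : 'F_p) (i : nat) :
  (i \in fibre s x) = (i%:R == x) && (i \in s).
Proof. by rewrite mem_filter. Qed.

Lemma size_fibre_sum (p : nat) (A S : seq nat) (x : 'F_p) (b : nat) :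
  uniq A -> (forall a, a \in A -> (a + b)%N \in S) ->
  (size (fibre A x) <= size (fibre S (x + b%:R)%R))%N.
Proof.
move=> uA AS; rewrite -(size_map (addn^~ b)); apply: uniq_leq_size.
  by rewrite map_inj_uniq ?filter_uniq //; apply: addIn.
move=> _ /mapP[i + ->]; rewrite !mem_fibre => /andP[/eqP <- iA].
by rewrite natrD eqxx AS.
Qed.

(* The largest element of the fibre, shifted by p, is a new element. *)
Lemma size_fibre_sumS (p : nat) (A S : seq nat) (x : 'F_p) : prime p ->
  uniq A -> (forall a, a \in A -> a \in S /\ (a + p)%N \in S) ->
  (0 < size (fibre A x))%N -> (size (fibre A x) < size (fibre S x))%N.
Proof.
move=> pp uA AS; have p0 := prime_gt0 pp.
move=> sz; have [j _ jmax] := @arg_maxnP _ (ord0 : 'I_(size (fibre A x)).-1.+1)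
    predT (fun j => nth 0%N (fibre A x) j) isT.
set M := nth 0%N (fibre A x) j in jmax.
have MA : M \in fibre A x by rewrite mem_nth // (leq_trans (ltn_ord j)) // prednK.
have iM i : i \in fibre A x -> (i <= M)%N.
  move=> iA; have ii : (index i (fibre A x) < (size (fibre A x)).-1.+1)%N.
    by rewrite prednK // index_mem.
  by have := jmax (Ordinal ii) isT; rewrite /= nth_index.
apply: (@leq_trans (size ((M + p)%N :: fibre A x))) => //.
apply: uniq_leq_size => [/=|i].
  rewrite filter_uniq // andbT; apply/negP => /iM; lia.
rewrite inE => /orP[/eqP ->|]; rewrite ?mem_fibre.
  move: MA; rewrite mem_fibre => /andP[/eqP Mx /AS[_ ->]].
  by rewrite natrD pchar_Fp_0 // addr0 Mx eqxx.
by move=> /andP[-> /AS[->]].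
Qed.

(** The 2 subtracted from [size B] has two sources: [0] and [p] share a residue, and
    Cauchy-Davenport loses one more. The witness [n] is the largest fibre size of [A]. *)
Theorem sumset_nat_lower_bound (p m : nat) (A B S : seq nat) : prime p ->
  uniq A -> uniq B -> A != [::] -> (forall i, i \in A -> i < m * p)%N ->
  (forall i, i \in B -> i <= p)%N -> 0%N \in B -> p \in B ->
  (forall a b, a \in A -> b \in B -> (a + b)%N \in S) ->
  (size A + p <= size S)%N \/
  exists n, [/\ (0 < n)%N, (n <= m)%N &
    (2 * n.+1 * size A + n * n.+1 * (size B - 2) <= 2 * n * size S)%N].
Proof.
move=> pp uA uB A0 Am Bp B0 pB AS.
have p0 := prime_gt0 pp.
pose al (x : 'F_p) := size (fibre A x); pose si (x : 'F_p) := size (fibre S x).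
pose Bb : {set 'F_p} := [set x | (0 < size (fibre B x))%N].
have BbP b : b \in B -> b%:R \in Bb.
  move=> bB; rewrite inE -has_predT; apply/hasP; exists b => //.
  by rewrite mem_fibre eqxx.
have BbN0 : Bb != set0 by apply/set0Pn; exists 0%:R; exact: BbP.
have cardBb : (size B <= #|Bb|.+1)%N.
  (* Once [p] is removed, the elements of [B] are below [p], so their residues are distinct. *)
  rewrite (perm_size (perm_to_rem pB)) /= ltnS.
  rewrite -(size_map (fun i => i%:R : 'F_p)) cardE; apply: uniq_leq_size.
    rewrite map_inj_in_uniq ?rem_uniq // => i j.
    rewrite !mem_rem_uniq // !inE => /andP[ip /Bp ip'] /andP[jp /Bp jp'].
    move/(congr1 val); rewrite /= !val_Fp_nat // !modn_small //; lia.
  move=> _ /mapP[i + ->]; rewrite mem_rem_uniq // !inE => /andP[_ iB].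
  by rewrite mem_enum BbP.
(* Levels are numbered from 0: [Al k] holds the residues with at least [k + 1] representatives. *)
pose Al k := [set x | (k < al x)%N]; pose Sl k := [set x | (k < si x)%N].
pose n := \max_x al x.
have n_gt0 : (0 < n)%N.
  case: A A0 @al @Al @n {uA Am AS} => // a s _ al Al n.
  apply: (leq_trans _ (leq_bigmax (a%:R : 'F_p))).
  by rewrite /al /= eqxx.
have n_le : (n <= m)%N by apply/bigmax_leqP => x _; exact: size_fibre_le.
have al_n x : (al x <= n)%N by exact: leq_bigmax.
have Al0 k : (k < n)%N -> Al k != set0.
  move=> kn; have [|x nE] := @bigop.eq_bigmax _ al.
    by rewrite card_Fp.
  by apply/set0Pn; exists x; rewrite inE -nE.
have sumA : size A = (\sum_(k < n) #|Al k|)%N.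
  rewrite sum_card_level -(sum_size_fibre p); apply: eq_bigr => x _.
  by apply/esym/minn_idPl.
have sumS : (\sum_(k < n.+1) #|Sl k| <= size S)%N.
  rewrite sum_card_level -(sum_size_fibre p); apply: leq_sum => x _.
  exact: geq_minl.
have SlS k : (#|Al k| <= #|Sl k.+1|)%N.
  apply/subset_leq_card/subsetP => x; rewrite !inE => kx.
  apply: (leq_ltn_trans kx); apply: size_fibre_sumS => //.
  - by move=> a aA; split; [rewrite -[a]addn0|]; apply: AS.
  - exact: (leq_ltn_trans (leq0n k)).
have SlB k : (k < n)%N -> (minn p (#|Al k| + #|Bb|).-1 <= #|Sl k|)%N.
  move=> kn; apply: (leq_trans (Cauchy_Davenport pp (Al0 _ kn) BbN0)).
  apply/subset_leq_card/subsetP => _ /imset2P[x y + + ->]; rewrite !inE => kx.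
  rewrite -has_predT => /hasP[b]; rewrite mem_fibre => /andP[/eqP <- bB] _.
  by apply: (leq_trans kx); apply: size_fibre_sum => // a aA; apply: AS.
have Bbgt0 : (0 < #|Bb|)%N by rewrite card_gt0.
(* In the first case [Sl 0] is everything, and the higher levels of [S] account for [size A]. In the
   second, the levels of [A] decrease, so the minimum in [SlB] is never [p]. *)
have [big|small] := leqP p (#|Al 0%N| + #|Bb|).-1.
  left; rewrite sumA; apply: leq_trans sumS; rewrite big_ord_recl addnC leq_add //.
    by rewrite -[X in (X <= _)%N](minn_idPl big) SlB.
  by apply: leq_sum => k _; exact: SlS.
right; exists n; split=> //.
have Alk k : (#|Al k| <= #|Al 0%N|)%N.
  by apply/subset_leq_card/subsetP => x; rewrite !inE; exact: leq_ltn_trans.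
rewrite sumA; apply: (@leq_trans (2 * n * (\sum_(k < n.+1) #|Sl k|))).
  apply: (@interlaced_sum_le _ _ (fun k => #|Al k|) (fun k => #|Sl k|)) => k kn;
    last exact: SlS.
  by apply: leq_trans (SlB k kn); rewrite leq_min; have := Alk k; lia.
by rewrite leq_mul2l sumS orbT.
Qed.

(** * Discretisation of compact sets *)

(* Imported only now: classical sets shadow the names used for finite sets. *)
From mathcomp Require Import all_classical all_reals all_analysis.
From mathcomp Require Import measurable_realfun.

Import numFieldNormedType.Exports.

Local Open Scope classical_set_scope.
Local Open Scope ring_scope.

(** Each point of [S] has a ball of some radius [r] inside [U]; half of [r] is spent on moving the
    centre, the other half on reaching [z]. Compactness makes the radius uniform. *)
Lemma compact_open_fattening (R : realType) (S U : set R) :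
  compact S -> open U -> S `<=` U ->
  exists2 e : R, 0 < e & forall x z, S x -> `|z - x| < e -> U z.
Proof.
move=> /compact_near_coveringP cS oU SU.
have [x Sx|e /= e0 eP] := cS R (0^'+) (fun e x => forall z, `|z - x| < e -> U z).
  have /nbhs_ballP[r /= r0 rU] : nbhs x U.
    by apply: open_nbhs_nbhs; split => //; exact: SU.
  exists (ball x (r / 2), [set e | e < r / 2]) => /=.
    split; first by apply: nbhsx_ballx; rewrite divr_gt0.
    by apply: nbhs_right_lt; rewrite divr_gt0.
  move=> [y e] /= [xy er] z zy; apply: rU; rewrite /ball /=.
  move: xy; rewrite /ball /= => xy.
  rewrite -(subrKA y) (le_lt_trans (ler_normD _ _)) // [`|y - z|]distrC.
  lra.
exists (e / 2); first by rewrite divr_gt0.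
move=> x z Sx xz; apply: (eP (e / 2) _ _ x Sx z xz); rewrite ?divr_gt0 //=.
rewrite sub0r normrN ger0_norm ?divr_ge0 ?ltW //; lra.
Qed.

(** Half-open, so that consecutive cells tile an interval without overlap. *)
Definition cell (R : realType) (w h : R) (i : nat) : set R :=
  `[w + i%:R * h, w + i.+1%:R * h[%classic.

Lemma measurable_cell (R : realType) (w h : R) (i : nat) :
  measurable (cell w h i : set (measurableTypeR R)).
Proof. exact: measurable_itv. Qed.
#[local] Hint Resolve measurable_cell : core.

Lemma lebesgue_measure_cell (R : realType) (w h : R) (i : nat) : 0 < h ->
  lebesgue_measure (cell w h i) = h%:E.
Proof.
move=> h0; rewrite lebesgue_measure_itv /= lte_fin -EFinB.
rewrite ifT; first by congr EFin; rewrite -natr1; ring.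
by rewrite -natr1; lra.
Qed.

Lemma itv_cellS (R : realType) (w h : R) (N : nat) : 0 < h ->
  `[w, w + N.+1%:R * h[%classic = `[w, w + N%:R * h[%classic `|` cell w h N.
Proof.
move=> h0; have N0 : 0 <= N%:R * h by rewrite mulr_ge0 // ltW.
have Nh : N.+1%:R * h = N%:R * h + h by rewrite -natr1; ring.
apply/seteqP; split=> x; rewrite /cell /= !in_itv /= Nh.
  move=> /andP[wx xN]; have [xlt|xge] := ltP x (w + N%:R * h).
    by left; rewrite wx.
  by right; rewrite xN.
by move=> [/andP[wx xN]|/andP[wx xN]]; apply/andP; split; lra.
Qed.

Lemma measureI_cellS (R : realType) (X : set R) (w h : R) (N : nat) :
  measurable (X : set (measurableTypeR R)) -> 0 < h ->
  (lebesgue_measure (X `&` `[w, (w + N.+1%:R * h)%R[%classic) =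
   lebesgue_measure (X `&` `[w, (w + N%:R * h)%R[%classic) +
   lebesgue_measure (X `&` cell w h N))%E.
Proof.
move=> mX h0; rewrite itv_cellS // setIUr measureU //; first exact: measurableI.
  exact: measurableI.
rewrite -subset0 => x [[_ +] [_]]; rewrite /cell /= !in_itv /=.
by move=> /andP[_ a] /andP[b _]; move: (lt_le_trans a b); rewrite ltxx.
Qed.

Definition grid (N : nat) (P : nat -> Prop) : seq nat :=
  [seq i <- iota 0 N | `[< P i >]].

Lemma mem_grid (N : nat) (P : nat -> Prop) (i : nat) :
  (i \in grid N P) <-> P i /\ (i < N)%N.
Proof.
rewrite mem_filter mem_iota /= add0n; split=> [/andP[/asboolP]|[? ->]] //.
by rewrite andbT; apply/asboolP.
Qed.

Lemma size_gridS (N : nat) (P : nat -> Prop) :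
  size (grid N.+1 P) = (size (grid N P) + `[< P N >])%N.
Proof. by rewrite /grid -addn1 iotaD filter_cat size_cat /=; case: ifP. Qed.

(** Cells that meet the set count it from above, which suits [A] and [B]; the sumset is counted from
    below, by the cells inside an open neighbourhood of it. *)
Lemma measure_le_cells (R : realType) (X : set R) (w h : R) (N : nat) :
  measurable (X : set (measurableTypeR R)) -> 0 < h ->
  (lebesgue_measure (X `&` `[w, (w + N%:R * h)%R[%classic) <=
   ((size (grid N (fun i => X `&` cell w h i !=set0)))%:R * h)%:E)%E.
Proof.
move=> mX h0; elim: N => [|N IHN].
  by rewrite !mul0r addr0 set_itvco0 setI0 measure0.
rewrite measureI_cellS // size_gridS natrD mulrDl EFinD leeD //.
case: asboolP => [_|/set0P/negP/negPn/eqP ->]; last by rewrite measure0 mul0r.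
rewrite mul1r -(lebesgue_measure_cell w N) // le_measure ?inE //.
by apply: measurableI.
Qed.

Lemma cells_le_measure (R : realType) (X : set R) (w h : R) (N : nat) :
  measurable (X : set (measurableTypeR R)) -> 0 < h ->
  (((size (grid N (fun i => cell w h i `<=` X)))%:R * h)%:E <=
   lebesgue_measure X)%E.
Proof.
move=> mX h0; suff : (((size (grid N (fun i => cell w h i `<=` X)))%:R * h)%:E <=
   lebesgue_measure (X `&` `[w, (w + N%:R * h)%R[%classic))%E.
  move=> /le_trans; apply; rewrite le_measure ?inE //; exact: measurableI.
elim: N => [|N IHN]; first by rewrite mul0r measure_ge0.
rewrite measureI_cellS // size_gridS natrD mulrDl EFinD leeD //.
case: asboolP => [/setIidr ->|_]; last by rewrite mul0r measure_ge0.
by rewrite mul1r lebesgue_measure_cell.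
Qed.

Lemma compact_sumset (R : realType) (A B : set R) :
  compact A -> compact B -> compact (sumset A B).
Proof.
move=> cA cB.
have -> : sumset A B = (fun x : R * R => x.1 + x.2) @` (A `*` B).
  apply/seteqP; split=> [_ [a Aa [b Bb <-]]|_ [[a b] [/= Aa Bb] <-]].
    by exists (a, b).
  by exists a => //; exists b.
apply: continuous_compact; last exact: compact_setX.
by apply: continuous_subspaceT => x; exact: add_continuous.
Qed.

Lemma compact_measureE (R : realType) (A : set R) : compact A ->
  lebesgue_measure A = (fine (lebesgue_measure A))%:E.
Proof.
by move=> /compact_finite_measure A_fin; rewrite fineK // ge0_fin_numE.
Qed.

Lemma cell_floor (R : realType) (w h x : R) : 0 < h -> w <= x ->
  cell w h `|Num.floor ((x - w) / h)|%N x.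
Proof.
move=> h0 wx; have q0 : 0 <= (x - w) / h by rewrite divr_ge0 ?subr_ge0 // ltW.
set i := `|_|%N; have iE : i%:R = (Num.floor ((x - w) / h))%:~R :> R.
  by rewrite /i natr_absz ger0_norm // floor_ge0.
rewrite /cell /= in_itv /= -natr1 iE -lerBrDl -ltrBlDl.
by rewrite -ler_pdivlMr // -ltr_pdivrMr // floor_le /= -intrD1 floorD1_gt.
Qed.

(** A sum of points from cells [i] and [j] may leave cell [i + j], but stays within [2 * h] of all
    its points. Hence the sumset is fattened to an open [U] of measure at most [s + e], which
    contains cell [i + j] once [h] is small. The two lost cells of [B] cost [2 * h < e]. *)
Lemma compact_sumset_lower_bound (R : realType) (A B : set R)
    (u v b0 b1 e : R) (m : nat) :
  compact A -> A !=set0 -> A `<=` `[u, v]%classic ->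
  compact B -> B b0 -> B b1 -> B `<=` `[b0, b1]%classic ->
  b0 < b1 -> v - u < m%:R * (b1 - b0) -> 0 < e ->
  let a := fine (lebesgue_measure A) in
  let b := fine (lebesgue_measure B) in
  let s := fine (lebesgue_measure (sumset A B)) in
  a + (b1 - b0) <= s + e \/
  exists n, [/\ (0 < n)%N, (n <= m)%N &
    (n%:R + 1) / n%:R * a + (n%:R + 1) / 2 * (b - e) <= s + e].
Proof.
move=> cA A0 Auv cB Bb0 Bb1 Bb b01 vu e0 a b s.
have cS := compact_sumset cA cB.
have [U [oU SU Ue]] := lebesgue_regularity_outer (compact_measurable cS)
  (compact_finite_measure cS) e0.
have [r r0 rU] := compact_open_fattening cS oU SU.
pose D := b1 - b0; have D0 : 0 < D by rewrite subr_gt0.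
have muU : (lebesgue_measure U <= (s + e)%:E)%E.
  have -> : U = sumset A B `|` (U `\` sumset A B) by rewrite setDUK.
  apply: (le_trans (measureU2 _ _ _)) => //.
  - exact: compact_measurable.
  - apply: measurableD; [exact: open_measurable | exact: compact_measurable].
  - by rewrite EFinD leeD //; [rewrite /s -compact_measureE|exact: ltW].
have [p] : exists p, prime p /\ D / p%:R < Num.min r e / 2.
  pose N := `|Num.floor (D / (Num.min r e / 2))|%N.+1.
  have [p Np pp] := prime_above N; exists p; split => //.
  have re0 : 0 < Num.min r e / 2 by rewrite divr_gt0 // lt_min r0.
  have p0 : 0 < p%:R :> R by rewrite ltr0n prime_gt0.
  rewrite ltr_pdivrMr // mulrC -ltr_pdivrMr //.
  apply: lt_trans (_ : N%:R < _); last by rewrite ltr_nat.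
  rewrite /N -[ltRHS]natr1 natr_absz ger0_norm -?intrD1 ?floorD1_gt //.
  by rewrite floor_ge0 divr_ge0 // ltW.
set h := D / p%:R => -[pp hre].
have p0 : 0 < p%:R :> R by rewrite ltr0n prime_gt0.
have h0 : 0 < h by rewrite divr_gt0.
have ph : p%:R * h = D by rewrite mulrC divfK // gt_eqF.
have [h2r h2e] : 2 * h < r /\ 2 * h < e.
  have : Num.min r e <= r by rewrite ge_min lexx.
  have : Num.min r e <= e by rewrite ge_min lexx orbT.
  by move=> ? ?; split; lra.
pose Ah := grid (m * p) (fun i => A `&` cell u h i !=set0).
(* One cell more than [p]: [b1] is the left endpoint of cell [p], so both [0] and [p] occur in
   [Bh]. *)
pose Bh := grid p.+1 (fun i => B `&` cell b0 h i !=set0).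
pose Sh := grid (m * p + p.+1) (fun i => cell (u + b0) h i `<=` U).
(* The bound on [v - u] is strict, so even [v] falls inside the half-open range of [m * p] cells. *)
have Auv' : A `<=` `[u, u + (m * p)%:R * h[%classic.
  move=> x /Auv; rewrite /= !in_itv /= natrM -mulrA ph /D.
  by move=> /andP[ux xv]; rewrite ux /=; lra.
have Bb' : B `<=` `[b0, b0 + p.+1%:R * h[%classic.
  move=> x /Bb; rewrite /= !in_itv /= -natr1 mulrDl ph mul1r /D.
  by move=> /andP[ux xv]; rewrite ux /=; lra.
have Ah_size : a <= (size Ah)%:R * h.
  have := measure_le_cells u (m * p) (compact_measurable cA) h0.
  by rewrite setIidl // (compact_measureE cA) lee_fin.
have Bh_size : b <= (size Bh)%:R * h.
  have := measure_le_cells b0 p.+1 (compact_measurable cB) h0.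
  by rewrite setIidl // (compact_measureE cB) lee_fin.
have Sh_size : (size Sh)%:R * h <= s + e.
  rewrite -lee_fin (le_trans _ muU) //.
  by apply: cells_le_measure => //; exact: open_measurable.
have uniq_grid N P : uniq (grid N P) by rewrite filter_uniq ?iota_uniq.
have [] := @sumset_nat_lower_bound p m Ah Bh Sh pp (uniq_grid _ _) (uniq_grid _ _).
- case: A0 => x Ax; have := Auv' _ Ax; rewrite /= in_itv /= => /andP[ux xm].
  have xc := cell_floor h0 ux.
  suff : `|Num.floor ((x - u) / h)|%N \in Ah by apply: contraTneq => ->.
  apply/mem_grid; split; first by exists x.
  move: xc; rewrite /cell /= in_itv /= => /andP[+ _] => /le_lt_trans/(_ xm).
  by rewrite ltrD2l ltr_pM2r // ltr_nat.
- by move=> i /mem_grid[].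
- by move=> i /mem_grid[_]; rewrite ltnS.
- apply/mem_grid; split => //; exists b0; split => //.
  by rewrite /cell /= in_itv /= mul0r addr0 lexx mul1r ltrDl.
- apply/mem_grid; split => //; exists b1; split => //.
  rewrite /cell /= in_itv /= -natr1 mulrDl ph mul1r /D; apply/andP; split; lra.
- move=> i j /mem_grid[[x [Ax xi]] im] /mem_grid[[y [By yj]] jp].
  apply/mem_grid; split; last by rewrite -addSn leq_add // ltnW.
  move=> z zij; apply: (rU (x + y)); first by exists x => //; exists y.
  move: xi yj zij; rewrite /cell /= !in_itv /= -!natr1 natrD !mulrDl !mul1r.
  move=> /andP[x1 x2] /andP[y1 y2] /andP[z1 z2].
  by rewrite ltr_norml; apply/andP; split; lra.
- move=> ApS; left; move: ApS; rewrite -(ler_nat R) natrD => ApS.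
  apply: le_trans Sh_size; apply: le_trans (_ : ((size Ah)%:R + p%:R) * h <= _).
    by rewrite mulrDl ph lerD2r.
  by rewrite ler_pM2r.
- move=> [n [n0 nm nP]]; right; exists n; split => //.
  have n0' : 0 < n%:R :> R by rewrite ltr0n.
  apply: le_trans Sh_size.
  (* Truncated subtraction only increases the value, which is the direction needed. *)
  have B2 : (size Bh)%:R - 2 <= (size Bh - 2)%:R :> R.
    have [le2|lt2] := leqP 2 (size Bh); first by rewrite natrB.
    by rewrite (le_trans _ (ler0n _ _)) // subr_le0 ler_nat ltnW.
  have be : b - e <= (size Bh - 2)%:R * h.
    apply: le_trans (_ : ((size Bh)%:R - 2) * h <= _); last by rewrite ler_pM2r.
    by rewrite mulrBl; lra.
  have nP' : 2 * (n%:R + 1) * (size Ah)%:R + n%:R * (n%:R + 1) * (size Bh - 2)%:R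
     <= 2 * n%:R * (size Sh)%:R :> R.
    by move: nP; rewrite -(ler_nat R) natrD !natrM -[n.+1%:R]natr1.
  apply: le_trans (_ : (n%:R + 1) / n%:R * ((size Ah)%:R * h) +
      (n%:R + 1) / 2 * ((size Bh - 2)%:R * h) <= _).
    by rewrite lerD // ler_wpM2l // divr_ge0 // addr_ge0 // ltW.
  rewrite -(@ler_pM2l _ (2 * n%:R)) ?mulr_gt0 //.
  rewrite [leRHS]mulrA.
  apply: le_trans (_ : _ <= (2 * n%:R * (size Sh)%:R) * h); last by [].
  apply: le_trans (ler_wpM2r (ltW h0) nP').
  by rewrite le_eqVlt; apply/orP; left; apply/eqP; field; rewrite gt_eqF.
Qed.

(** * Inner measure and approximation from inside *)

Lemma bounded_set_normP (R : realType) (S : set R) :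
  bounded_set S <-> exists M, forall x, S x -> `|x| <= M.
Proof.
split=> [[M [_ SM]]|[M SM]].
  by exists (M + 1) => x; apply: SM; rewrite ltrDl.
exists M; split; first exact: num_real.
by move=> y My x /SM/le_trans; apply; exact: ltW.
Qed.

Lemma bounded_sumset (R : realType) (A B : set R) :
  bounded_set A -> bounded_set B -> bounded_set (sumset A B).
Proof.
move=> /bounded_set_normP[M AM] /bounded_set_normP[N BN].
apply/bounded_set_normP; exists (M + N) => _ [a /AM aM [b /BN bN <-]].
exact: (le_trans (ler_normD _ _) (lerD aM bN)).
Qed.

Lemma bounded_has_ubound (R : realType) (S : set R) :
  bounded_set S -> has_ubound S.
Proof.
move=> /bounded_set_normP[M SM]; exists M => x /SM.
by rewrite ler_norml => /andP[].
Qed.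

Lemma bounded_has_lbound (R : realType) (S : set R) :
  bounded_set S -> has_lbound S.
Proof.
move=> /bounded_set_normP[M SM]; exists (- M) => x /SM.
by rewrite ler_norml => /andP[].
Qed.

Lemma bounded_sub_itv (R : realType) (S : set R) : bounded_set S ->
  S `<=` `[inf S, sup S]%classic.
Proof.
move=> bS x Sx; rewrite /= in_itv /=; apply/andP; split.
  exact: (ge_inf (bounded_has_lbound bS)).
exact: (ub_le_sup (bounded_has_ubound bS)).
Qed.

Lemma fine_measure_le (R : realType) (C E : set R) : compact C -> compact E ->
  C `<=` E -> fine (lebesgue_measure C) <= fine (lebesgue_measure E).
Proof.
move=> cC cE CE; rewrite -lee_fin -!compact_measureE //.
by apply: le_measure; rewrite ?inE //; exact: compact_measurable.
Qed.

Lemma fine_measure_itv (R : realType) (a b : R) : a <= b ->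
  fine (lebesgue_measure `[a, b]%classic) = b - a.
Proof.
move=> ab; rewrite lebesgue_measure_itv /= lte_fin; case: ltP => //= ba.
by apply/esym/eqP; rewrite subr_eq0 eq_le ab ba.
Qed.

(** [C] is covered by its part up to [v] together with [[v, s]]. *)
Lemma fine_measure_cut (R : realType) (C : set R) (l v s : R) :
  compact C -> C `<=` `[l, s]%classic -> v <= s ->
  fine (lebesgue_measure C) <=
  fine (lebesgue_measure (C `&` `[l, v]%classic)) + (s - v).
Proof.
move=> cC Cls vs.
have cC' : compact (C `&` `[l, v]%classic).
  by apply: compact_closedI => //; exact: itv_closed.
rewrite -lee_fin EFinD -!compact_measureE // -fine_measure_itv //.
rewrite -(compact_measureE (@segment_compact _ v s)).
apply: le_trans (_ : lebesgue_measure
   ((C `&` `[l, v]%classic) `|` `[v, s]%classic) <= _)%E; last first.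
  by apply: measureU2 => //; exact: compact_measurable.
apply: le_measure; rewrite ?inE; first exact: compact_measurable.
  by apply: measurableU => //; exact: compact_measurable.
move=> x Cx; have := Cls _ Cx; rewrite /= !in_itv /= => /andP[lx xs].
by have [xv|/ltW vx] := leP x v; [left; rewrite lx|right; rewrite vx].
Qed.

Section inner_lambda.
Context (R : realType) (S : set R) (bS : bounded_set S).

Let bnd C : compact C -> C `<=` S ->
  (lebesgue_measure C <= (`|sup S - inf S|)%:E)%E.
Proof.
move=> cC CS; have CiS := subset_trans CS (bounded_sub_itv bS).
apply: le_trans (_ : lebesgue_measure `[inf S, sup S]%classic <= _)%E.
  by apply: le_measure; rewrite ?inE //; exact: compact_measurable.
rewrite lebesgue_measure_itv /= lte_fin; case: ltP => // _.
by rewrite -EFinB lee_fin ler_norm.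
Qed.

(** The interval from [inf S] to [sup S] bounds the supremum and the empty set makes it nonnegative,
    so [fine] loses nothing. *)
Lemma inner_lambdaE : inner_lebesgue_measure S = (inner_lambda S)%:E.
Proof.
rewrite /inner_lambda fineK // ge0_fin_numE.
  apply: (le_lt_trans _ (ltry `|sup S - inf S|)).
  by apply: ge_ereal_sup => _ [C [cC CS] <-]; exact: bnd.
apply: ereal_sup_ubound; exists set0; last exact: measure0.
by split; [exact: compact0|].
Qed.

Lemma le_inner_lambda C : compact C -> C `<=` S ->
  fine (lebesgue_measure C) <= inner_lambda S.
Proof.
move=> cC CS; rewrite -lee_fin -inner_lambdaE -compact_measureE //.
by apply: ereal_sup_ubound; exists C.
Qed.

Lemma inner_lambda_ge0 : 0 <= inner_lambda S.
Proof. by have := le_inner_lambda compact0 (sub0set _); rewrite measure0. Qed.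

(** The loss is a factor [t] because the final bound is homogeneous. When the inner measure is 0 no
    strict approximation from below is available, and the empty set serves. *)
Lemma inner_lambda_approx (t : R) : t < 1 ->
  exists C, [/\ compact C, C `<=` S &
    t * inner_lambda S <= fine (lebesgue_measure C)].
Proof.
move=> t1; have := inner_lambda_ge0; rewrite le_eqVlt => /predU1P[<-|l0].
  exists set0; split; [exact: compact0|exact: sub0set|].
  by rewrite mulr0 measure0.
have /ereal_sup_gt[_ [C [cC CS] <-]] :
    ((t * inner_lambda S)%:E < inner_lebesgue_measure S)%E.
  by rewrite inner_lambdaE lte_fin gtr_pMl.
by rewrite compact_measureE // lte_fin => /ltW ?; exists C.
Qed.

Lemma inner_lambda_gt0_nonempty : 0 < inner_lambda S -> S !=set0.
Proof.
move=> l0; have [|C [cC CS Cl]] := @inner_lambda_approx (1 / 2); first by lra.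
apply/set0P/eqP => S0; move: CS; rewrite S0 subset0 => C0.
by move: Cl; rewrite C0 measure0 /=; lra.
Qed.

Lemma inner_lambda_gt0_diam : 0 < inner_lambda S -> 0 < diam S.
Proof.
move=> l0; have [|C [cC CS Cl]] := @inner_lambda_approx (1 / 2); first by lra.
have [x Sx] := inner_lambda_gt0_nonempty l0.
have := bounded_sub_itv bS Sx; rewrite /= in_itv /= => /andP[ix xs].
have := fine_measure_le cC (@segment_compact _ (inf S) (sup S))
  (subset_trans CS (bounded_sub_itv bS)).
rewrite fine_measure_itv ?(le_trans ix) // /diam; lra.
Qed.

(* Staying strictly below sup S keeps the number of points per residue class at
   most diam A / diam B when this ratio is an integer. *)
Lemma compact_approx_cut (t : R) : S !=set0 -> 0 < t -> t < 1 ->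
  exists C v, [/\ compact C, C !=set0, C `<=` S, C `<=` `[inf S, v]%classic &
    (0 < diam S -> v < sup S) /\ t * inner_lambda S <= fine (lebesgue_measure C)].
Proof.
move=> S0 t0 t1; pose t' := (1 + t) / 2.
have [|C [cC CS Ct]] := @inner_lambda_approx t'; first by rewrite /t'; lra.
have CiS := subset_trans CS (bounded_sub_itv bS).
(* Without positive diameter no cut is required; a point of [S] is added only to make the compact
   set nonempty. *)
have [dS|dS] := ltP 0 (diam S); last first.
  case: S0 => x Sx; exists (C `|` [set x]), (sup S).
  have cCx : compact (C `|` [set x]) by apply: compactU => //; exact: compact_set1.
  have CxS : C `|` [set x] `<=` S by rewrite subUset; split => // _ ->.
  split=> //; [by exists x; right|exact: subset_trans CxS (bounded_sub_itv bS)|].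
  split=> //; have : fine (lebesgue_measure C) <= fine (lebesgue_measure (C `|` [set x])).
    by apply: fine_measure_le => //; exact: subsetUl.
  by have := inner_lambda_ge0; rewrite /t' in Ct; nra.
have [x Sx xs] : exists2 x, S x & x < sup S.
  have [x Sx] := inf_adherent dS (conj S0 (bounded_has_lbound bS)).
  by rewrite /diam addrC subrK => xs; exists x.
(* Cutting off a length [d] loses at most measure [d]; [(1 - t) / 2 * inner_lambda S] is what
   remains between the factors [t'] and [t]. *)
have [d d0 dl] : exists2 d, 0 < d & t' * inner_lambda S - d >= t * inner_lambda S \/
    inner_lambda S = 0.
  have := inner_lambda_ge0; rewrite le_eqVlt => /predU1P[<-|l0].
    by exists 1 => //; right.
  by exists ((1 - t) / 2 * inner_lambda S); [nra|left; rewrite /t'; nra].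
pose v := Num.max x (sup S - d).
have vs : v < sup S by rewrite gt_max xs /=; lra.
exists ((C `&` `[inf S, v]%classic) `|` [set x]), v.
have cC' : compact (C `&` `[inf S, v]%classic).
  by apply: compact_closedI => //; exact: itv_closed.
have cCx : compact ((C `&` `[inf S, v]%classic) `|` [set x]).
  by apply: compactU => //; exact: compact_set1.
split => //.
- by exists x; right.
- by rewrite subUset; split => [y [/CS]|_ ->].
- rewrite subUset; split => [y []//|_ -> /=]; rewrite in_itv /= le_max lexx andbT.
  exact: (ge_inf (bounded_has_lbound bS)).
split => //; case: dl => [dl|->]; last by rewrite mulr0 fine_ge0.
have cut := fine_measure_cut cC CiS (ltW vs).
have : fine (lebesgue_measure (C `&` `[inf S, v]%classic)) <=
   fine (lebesgue_measure ((C `&` `[inf S, v]%classic) `|` [set x])).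
  by apply: fine_measure_le => //; exact: subsetUl.
have : sup S - d <= v by rewrite le_max lexx orbT.
lra.
Qed.

(** Adding two points close to [inf S] and [sup S] brings the diameter above [c] without lowering
    the measure. Compactness then provides attained endpoints, which the discretisation needs. *)
Lemma compact_approx_diam (t c : R) : S !=set0 -> t < 1 -> c < diam S ->
  exists C b0 b1, [/\ compact C, C `<=` S, C b0 /\ C b1, C `<=` `[b0, b1]%classic &
    c < b1 - b0 /\ t * inner_lambda S <= fine (lebesgue_measure C)].
Proof.
move=> S0 t1 cd; pose e := (diam S - c) / 2.
have e0 : 0 < e by rewrite divr_gt0 // subr_gt0.
have [C [cC CS Ct]] := inner_lambda_approx t1.
have [x Sx xe] := inf_adherent e0 (conj S0 (bounded_has_lbound bS)).
have [y Sy ye] := sup_adherent e0 (conj S0 (bounded_has_ubound bS)).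
pose E := C `|` [set x] `|` [set y].
have cE : compact E.
  by apply: compactU; [apply: compactU => //|]; exact: compact_set1.
have ES : E `<=` S by rewrite !subUset; split; [split=> // _ ->|move=> _ ->].
have E0 : E !=set0 by exists x; left; right.
have cid : {within E, continuous (@id R)}.
  by apply: continuous_subspaceT => z; exact: cvg_id.
have [b1 /set_mem Eb1 b1P] := compact_EVT_max E0 cE cid.
have [b0 /set_mem Eb0 b0P] := compact_EVT_min E0 cE cid.
exists E, b0, b1; split => //.
  by move=> z /mem_set Ez; rewrite /= in_itv /= b0P // b1P.
have Ex : x \in E by apply: mem_set; left; right.
have Ey : y \in E by apply: mem_set; right.
split.
  by have := b0P _ Ex; have := b1P _ Ey; rewrite /e /diam /= in xe ye *; lra.
apply: le_trans Ct _; apply: fine_measure_le => // z Cz; left; by left.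
Qed.

End inner_lambda.

(** * The lower bound for bounded sets *)

(** The averaged bound for residue classes with at most [n] elements of [A]. It is meant for
    positive [n]; at 0 the first quotient takes the default value 0. *)
Definition sumset_bound (R : realType) (n : nat) (a b : R) : R :=
  (n%:R + 1) / n%:R * a + (n%:R + 1) / 2 * b.

Lemma sumset_bound_mono (R : realType) (n : nat) (a a' b b' : R) :
  a <= a' -> b <= b' -> sumset_bound n a b <= sumset_bound n a' b'.
Proof. by move=> aa bb; rewrite lerD // ler_wpM2l // divr_ge0 // addr_ge0. Qed.

Lemma sumset_boundZ (R : realType) (n : nat) (t a b : R) :
  sumset_bound n (t * a) (t * b) = t * sumset_bound n a b.
Proof. by rewrite /sumset_bound; ring. Qed.

(** With [j = n - K], the difference is a nonnegative multiple of [j (j + 1 - 2 d)]. As [1 - 2 d]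
    lies between -1 and 1, this is nonnegative for every integer [j]. *)
Lemma sumset_bound_min (R : realType) (n K : nat) (a b d : R) :
  (0 < n)%N -> 0 < b -> 0 <= d -> d < 1 ->
  a = b * (K%:R * (K%:R - 1) / 2 + K%:R * d) ->
  a + (K%:R + d) * b <= sumset_bound n a b.
Proof.
move=> n0 b0 d0 d1 aE; rewrite /sumset_bound.
have n0' : 0 < n%:R :> R by rewrite ltr0n.
rewrite -subr_ge0.
have -> : (n%:R + 1) / n%:R * a + (n%:R + 1) / 2 * b - (a + (K%:R + d) * b) =
  b / (2 * n%:R) * ((n%:R - K%:R) ^+ 2 + (n%:R - K%:R) * (1 - 2 * d)).
  by rewrite aE; field; rewrite gt_eqF.
apply: mulr_ge0; first by rewrite divr_ge0 ?mulr_ge0 // ltW.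
have [nK|Kn|->] := ltngtP n K; last by rewrite subrr expr0n mul0r addr0.
- have : n%:R + 1 <= K%:R :> R by rewrite natr1 ler_nat.
  by nra.
- have : K%:R + 1 <= n%:R :> R by rewrite natr1 ler_nat.
  by nra.
Qed.

(** The difference has the sign of [2 a - n m b], and [n < m <= K] gives [n m <= K (K - 1)]. *)
Lemma sumset_bound_decr (R : realType) (n m K : nat) (a b : R) :
  (0 < n)%N -> (n <= m <= K)%N -> 0 <= b -> K%:R * (K%:R - 1) / 2 * b <= a ->
  sumset_bound m a b <= sumset_bound n a b.
Proof.
move=> n0 /andP[+ mK] b0 aK; rewrite leq_eqVlt => /predU1P[->//|nm].
have n0' : 0 < n%:R :> R by rewrite ltr0n.
have m0' : 0 < m%:R :> R by rewrite ltr0n (ltn_trans n0).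
rewrite -subr_ge0 /sumset_bound.
have -> : (n%:R + 1) / n%:R * a + (n%:R + 1) / 2 * b -
   ((m%:R + 1) / m%:R * a + (m%:R + 1) / 2 * b) =
  (m%:R - n%:R) / (2 * n%:R * m%:R) * (2 * a - n%:R * m%:R * b).
  by field; rewrite !gt_eqF.
have nm' : n%:R + 1 <= m%:R :> R by rewrite natr1 ler_nat.
have mK' : m%:R <= K%:R :> R by rewrite ler_nat.
apply: mulr_ge0; first by rewrite divr_ge0 ?mulr_ge0 ?ltW //; lra.
have : n%:R * m%:R <= K%:R * (K%:R - 1) :> R by nra.
by nra.
Qed.

(** The compact bound is applied inside [A] and [B], with all losses put into [t] and [e]. The
    witness [n] may vary with them; only under the two diameter conditions is it bounded by [m]. *)
Lemma inner_sumset_approx (R : realType) (A B : set R) (m : nat) (t e : R) :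
  A !=set0 -> bounded_set A -> bounded_set B -> 0 < inner_lambda B ->
  0 < t -> t < 1 -> 0 < e ->
  t * (inner_lambda A + diam B) <= inner_lambda (sumset A B) + e \/
  exists n, [/\ (0 < n)%N,
    0 < diam A -> diam A <= m%:R * diam B -> (n <= m)%N &
    t * sumset_bound n (inner_lambda A) (inner_lambda B) <=
      inner_lambda (sumset A B) + e].
Proof.
move=> A0 bA bB lB t0 t1 e0.
have dB := inner_lambda_gt0_diam bB lB.
have B0 := inner_lambda_gt0_nonempty bB lB.
have [A' [v [cA' A'0 A'A A'v [vs A't]]]] := compact_approx_cut bA A0 t0 t1.
pose Q := 0 < diam A /\ diam A <= m%:R * diam B.
(* [c] is a diameter that the compact part of [B] must exceed. Under [Q], [v < sup A] gives
   [(v - inf A) / m < diam B], which leaves room for such a [c] with [m' = m]; otherwise a large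
   [m'] is taken. *)
have [m' [c [ct cd cm mm]]] : exists m' c, [/\ t * diam B <= c, c < diam B,
    forall d, c < d -> v - inf A < m'%:R * d & Q -> m' = m].
  have tB : t * diam B < diam B by rewrite gtr_pMl.
  have [q|nq] := pselect Q.
    have [dA dAB] := q; have {vs} vs := vs dA.
    have m0 : 0 < m%:R :> R.
      by rewrite lt_def ler0n andbT; apply: contraTneq dAB => ->; rewrite mul0r -ltNge.
    exists m, (Num.max (t * diam B) ((v - inf A) / m%:R)); split => //.
    - by rewrite le_max lexx.
    - rewrite gt_max tB /= ltr_pdivrMr // mulrC (lt_le_trans _ dAB) //.
      by rewrite /diam ltrD2r.
    - by move=> d; rewrite gt_max => /andP[_]; rewrite ltr_pdivrMr // mulrC.
  exists (`|Num.floor (`|v - inf A| / (t * diam B))%R|%N.+1), (t * diam B).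
  split=> // d td.
  have d0 : 0 < t * diam B by rewrite mulr_gt0.
  rewrite -ltr_pdivrMr ?(lt_trans d0) //.
  rewrite -[ltRHS]natr1 natr_absz ger0_norm; last by rewrite floor_ge0 divr_ge0 // ltW.
  rewrite -intrD1 (le_lt_trans _ (floorD1_gt _)) //.
  rewrite ler_pdivrMr ?(lt_trans d0) //.
  apply: (le_trans (ler_norm _)); rewrite mulrAC ler_pdivlMr // ler_wpM2l //.
  exact: ltW.
pose t' := (1 + t) / 2.
have t'1 : t' < 1 by rewrite /t'; lra.
have [B' [b0 [b1 [cB' B'B [B'b0 B'b1] B'b [cb B't]]]]] :=
  compact_approx_diam bB B0 t'1 cd.
(* The second term ensures [t' * inner_lambda B - e' >= t * inner_lambda B]. *)
pose e' := Num.min e ((1 - t) / 2 * inner_lambda B).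
have e'0 : 0 < e' by rewrite lt_min e0 mulr_gt0 // divr_gt0 //; lra.
have b01 : b0 < b1.
  by rewrite -subr_gt0 (le_lt_trans _ cb) // (le_trans _ ct) // mulr_ge0 // ltW.
have sS : fine (lebesgue_measure (sumset A' B')) <= inner_lambda (sumset A B).
  apply: (le_inner_lambda (bounded_sumset bA bB)); first exact: compact_sumset.
  by move=> _ [x A'x [y B'y <-]]; exists x; [exact: A'A|exists y => //; exact: B'B].
have e'e : e' <= e by rewrite ge_min lexx.
have e'B : e' <= (1 - t) / 2 * inner_lambda B by rewrite ge_min lexx orbT.
have [le|[n [n0 nm le]]] := compact_sumset_lower_bound cA' A'0 A'v cB' B'b0 B'b1
    B'b b01 (cm _ cb) e'0; [left|right].
  by rewrite mulrDr; lra.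
exists n; split=> // [dA dAB|]; first by rewrite -(mm _).
rewrite -sumset_boundZ; apply: (le_trans (sumset_bound_mono n A't _)).
  2: by apply: (le_trans le); lra.
rewrite /t' in B't; lra.
Qed.

(** The limit in [t] and [e] is taken by contradiction. Since [n] may change with them, [M] has to
    lie below the bounds for all admissible [n]. *)
Lemma inner_sumset_dichotomy (R : realType) (A B : set R) (m : nat) (M : R) :
  A !=set0 -> bounded_set A -> bounded_set B -> 0 < inner_lambda B ->
  (forall n, (0 < n)%N ->
     (0 < diam A -> diam A <= m%:R * diam B -> (n <= m)%N) ->
     M <= sumset_bound n (inner_lambda A) (inner_lambda B)) ->
  inner_lambda (sumset A B) >= inner_lambda A + diam B \/
  inner_lambda (sumset A B) >= M.
Proof.
move=> A0 bA bB lB MP; set s := inner_lambda (sumset A B).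
have [|ltD] := leP (inner_lambda A + diam B) s; first by left.
have [|ltM] := leP M s; first by right.
have s0 : 0 <= s := inner_lambda_ge0 (bounded_sumset bA bB).
pose L := Num.min (inner_lambda A + diam B) M.
have sL : s < L by rewrite lt_min ltD.
have L0 : 0 < L by exact: le_lt_trans sL.
(* This puts [t * L] halfway between [s] and [L]; an error of a quarter of the gap then keeps
   [s + e] below [t * L]. *)
pose t := (s + L) / (2 * L).
have tL : t * L = (s + L) / 2 by rewrite /t; field; rewrite gt_eqF.
have t0 : 0 < t by rewrite divr_gt0 ?mulr_gt0 // ltr_wpDl.
have t1 : t < 1 by rewrite ltr_pdivrMr ?mulr_gt0 //; lra.
have e0 : 0 < (L - s) / 4 by lra.
exfalso; have [] := inner_sumset_approx m A0 bA bB lB t0 t1 e0; rewrite -/s.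
  have : t * L <= t * (inner_lambda A + diam B).
    by rewrite ler_pM2l // ge_min lexx.
  by lra.
move=> [n [n0 nm le]]; have : t * L <= t * M by rewrite ler_pM2l // ge_min lexx orbT.
have : t * M <= t * sumset_bound n (inner_lambda A) (inner_lambda B).
  by rewrite ler_pM2l // MP.
by lra.
Qed.

(** For empty [A] the sumset is empty, [K = 1] and [delta = 0], and both alternatives of the first
    claim fail; hence the nonemptiness assumption. *)
Theorem theorem2p2 (R : realType) (A B : set R)
    (A_nonempty : A !=set0)
    (A_bounded : bounded_set A) (B_bounded : bounded_set B)
    (lambdaB_neq0 : inner_lambda B <> 0)
    (K : nat) (delta : R)
    (K_gt0 : (0 < K)%N) (delta_ge0 : 0 <= delta) (delta_lt1 : delta < 1)
    (ratioE : inner_lambda A / inner_lambda B =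
              K%:R * (K%:R - 1) / 2 + K%:R * delta) :
  (inner_lambda (sumset A B) >= inner_lambda A + diam B \/
   inner_lambda (sumset A B) >=
     inner_lambda A + (K%:R + delta) * inner_lambda B) /\
  (0 < diam A -> diam A / diam B <= K%:R ->
   inner_lambda (sumset A B) >= inner_lambda A + diam B \/
   inner_lambda (sumset A B) >=
     ((Num.ceil (diam A / diam B))%:~R + 1) / (Num.ceil (diam A / diam B))%:~R
       * inner_lambda A
     + ((Num.ceil (diam A / diam B))%:~R + 1) / 2 * inner_lambda B).
Proof.
have lB : 0 < inner_lambda B.
  by rewrite lt_def inner_lambda_ge0 // andbT; apply/eqP.
have dB := inner_lambda_gt0_diam B_bounded lB.
have lA : inner_lambda A = inner_lambda B * (K%:R * (K%:R - 1) / 2 + K%:R * delta).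
  by rewrite -ratioE mulrC divfK // gt_eqF.
split=> [|dA dAB].
  (* The estimate holds for every positive [n], so any value of [m] will do. *)
  apply: (inner_sumset_dichotomy (m := 0)) => // n n0 _.
  exact: sumset_bound_min.
have q0 : 0 < diam A / diam B by rewrite divr_gt0.
set c := Num.ceil _.
have c0 : 0 <= c by rewrite ceil_ge0 (lt_trans _ q0) // ltrN10.
have cE : c%:~R = `|c|%N%:R :> R by rewrite natr_absz ger0_norm.
rewrite cE -/(sumset_bound `|c|%N _ _).
apply: (inner_sumset_dichotomy (m := `|c|%N)) => // n n0 nm.
apply: (@sumset_bound_decr _ _ _ K) => //; last 2 first.
- exact: ltW.
- rewrite lA mulrC ler_pM2l // lerDl mulr_ge0 //.
(* The ceiling is at least the ratio of the diameters, which bounds [n]; it is at most [K] because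
   [K] is an integer above that ratio or equal to it. *)
apply/andP; split.
  by apply: nm => //; rewrite -ler_pdivrMr // -cE ceil_ge.
by rewrite -(ler_nat R) -cE -[K%:R]/(K%:Z%:~R) ler_int ceil_le_int.
Qed.
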